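(* Let $d \geq 1$ be a fixed dimension. Let $(N_n)_n$ be a sequence of natural numbers going to infinity, and let $(M_n)_n$ be a sequence (with $M_n \geq 1$) going to infinity such that $M_n = o_{n\to\infty}(N_n)$. For each $n$, suppose that we have functions $\nu_{i} = \nu_{i,n}: [N_n] \to [0,\infty)$, $i=1,\ldots,d$, such that these functions obey the linear forms condition (defined in the context). For each $n$, let $A_n$ be a subset of $[N_n]^d$, and suppose that $$\limsup_{n \to \infty} \mathbb{E}_{a \in [N_n]^d} 1_{A_n}(a) \prod_{i=1}^d \nu_{i,n}(a_i) \geq \delta$$ for some $\delta > 0$ (independent of $n$), where $a = (a_1,\ldots,a_d)$. Then there exist a $\mathbb{Z}^d$-system $(X, \mathcal{B}, \mu, (T_h)_{h \in \mathbb{Z}^d})$ and a set $E \in \mathcal{B}$ such that $$\mu(E) \geq \delta$$ and such that whenever $h_1,\ldots,h_k \in \mathbb{Z}^d$ are a finite number of shifts with $$\mu( T_{h_1} E \cap \ldots \cap T_{h_k} E) > 0,$$ then for a sequence of $n$ tending to infinity (i.e. for infinitely many $n$) there exist $a \in [N_n]^d$ and $r \in [M_n]$ such that $$a+rh_1, \ldots, a+rh_k \in A_n.$$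
   Context: Notation: $[x] := \{m \in \mathbb{Z} : 1 \leq m \leq x\}$. For a finite non-empty set $S$, $\mathbb{E}_{a \in S} f(a) := \frac{1}{|S|}\sum_{a \in S} f(a)$; iterated averages are written $\mathbb{E}_{a\in S}\mathbb{E}_{r\in S'}$. $X = o(Y)$ abbreviates $X = o_{n\to\infty}(Y)$, i.e. $X/Y \to 0$ as $n \to \infty$. Empty products equal $1$. ''Fixed'' means independent of $n$. A $\mathbb{Z}^d$-system is a quadruplet $(X,\mathcal{B},\mu,(T_h)_{h\in\mathbb{Z}^d})$ where $(X,\mathcal{B},\mu)$ is a probability space and for each $h\in\mathbb{Z}^d$, $T_h: X\to X$ is a measure-preserving bijection, with $T_{h+h'} = T_hT_{h'}$ for all $h,h'\in\mathbb{Z}^d$. Linear forms condition (for $N_n$, $M_n$, $\nu_{i,n}$): Let $m \geq 0$ be any fixed natural number, let $k_1,\ldots,k_d \geq 0$ be any fixed natural numbers, and for each $1 \leq i \leq d$ let $\phi_{i,1},\ldots,\phi_{i,k_i}: \mathbb{R}^m \to \mathbb{R}$ be any linear forms with integer coefficients such that, for each $1\leq i\leq d$, the forms $\phi_{i,1},\ldots,\phi_{i,k_i}$ are pairwise distinct. Then there exists a sequence $H_n = o(M_n)$ (which may depend on $m$, the $k_i$ and the $\phi_{i,j}$) such that whenever $L_{1,n},\ldots,L_{m,n} \geq 1$ are such that $H_n \leq L_{l,n} \leq M_n$ for all $1 \leq l \leq m$, one has $$\mathbb{E}_{a \in [N_n]^d}\, \mathbb{E}_{r \in \prod_{j=1}^m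 [L_{j,n}]} \prod_{i=1}^d \prod_{j=1}^{k_i} \nu_{i,n}(a_i + \phi_{i,j}(r)) = 1+o(1),$$ where $a = (a_1,\ldots,a_d)$ and each $\nu_{i,n}$ is extended by zero outside of $[N_n]$ to $\mathbb{Z}$. *)

(* Defs.v *)
From HB Require Import structures.
From mathcomp Require Export all_boot all_order all_algebra.
From mathcomp Require Export finmap.
From mathcomp Require Export all_classical all_reals all_analysis.

Set Implicit Arguments.
Unset Strict Implicit.
Unset Printing Implicit Defensive.

Import Order.TTheory GRing.Theory Num.Theory.
Import numFieldNormedType.Exports.

Local Open Scope classical_set_scope.
Local Open Scope ring_scope.

Definition intvl (R : realType) (x : R) : set int :=
  [set k : int | 1 <= k /\ k%:~R <= x].

(* For m = 0 this is a single point. *)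
Definition box (R : realType) (m : nat) (L : 'I_m -> R) : set 'rV[int]_m :=
  [set r : 'rV[int]_m | forall l, intvl (L l) (r ord0 l)].

(* Meant for finite S only: [fset_set S] is empty when S is infinite. *)
Definition avg (R : realType) (I : choiceType) (S : set I) (f : I -> R) : R :=
  (\sum_(a <- fset_set S) f a) / (#|` fset_set S|)%:R.

(* A linear form R^m -> R with integer coefficients is given by its row of
   coefficients, so distinct forms are distinct rows; it is only ever evaluated
   at integer points. *)
Definition linform (m : nat) (c r : 'rV[int]_m) : int :=
  \sum_(l < m) c ord0 l * r ord0 l.

Definition extend0 (R : realType) (N : nat) (f : int -> R) (x : int) : R :=
  if 1 <= x <= N%:Z then f x else 0.

(* The bounds H_n <= L_{l,n} <= M_n are only required for large n. Required for
   every n, they could be met by no L at all if H_n > M_n for a single n (which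
   H = o(M) does not exclude), and the condition would hold vacuously. As L
   ranges over all sequences, the o(1) is uniform in the choice of L_{l,n}. *)
Definition linear_forms_condition (R : realType) (d : nat) (N : nat -> nat)
    (M : nat -> R) (nu : nat -> 'I_d -> int -> R) : Prop :=
  forall (m : nat) (k : 'I_d -> nat)
    (phi : forall i : 'I_d, 'I_(k i) -> 'rV[int]_m),
  (forall i, injective (phi i)) ->
  exists H : nat -> R,
    H n / M n @[n --> \oo] --> (0 : R) /\
    forall L : nat -> 'I_m -> R,
      (forall n l, 1 <= L n l) ->
      (\forall n \near \oo, forall l, H n <= L n l <= M n) ->
      avg (box (fun _ : 'I_d => (N n)%:R : R)) (fun a =>
        avg (box (L n)) (fun r =>
          \prod_(i < d) \prod_(j < k i)
            extend0 (N n) (nu n i) (a ord0 i + linform (phi i j) r)))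
      @[n --> \oo] --> (1 : R).

Definition is_Zd_system (R : realType) (d : nat) (disp : measure_display)
    (X : measurableType disp) (mu : probability X R)
    (T : 'rV[int]_d -> X -> X) : Prop :=
  [/\ forall h, bijective (T h),
      forall h, measurable_fun setT (T h),
      forall h B, measurable B -> mu (T h @^-1` B) = mu B &
      forall h h', T (h + h') = T h \o T h'].

(* Main.v *)
Require Import Defs.
From HB Require Import structures.
From mathcomp Require Import all_boot all_order all_algebra.
From mathcomp Require Import finmap.
From mathcomp Require Import all_classical all_reals all_analysis.
From mathcomp Require Import ring lra zify.

Set Implicit Arguments.
Unset Strict Implicit.
Unset Printing Implicit Defensive.

Import Order.TTheory GRing.Theory Num.Theory.
Import numFieldNormedType.Exports.

Local Open Scope classical_set_scope.
Local Open Scope ring_scope.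

(** The idea is to sample random homothetic copies [a + r * {0, ..., K}^d] of a
    discrete cube, weighting each copy by the product of all the values
    [nu_i (a_i + x * r)], [0 <= x <= K], attached to it.

    By the linear forms condition the total weight tends to 1. Moreover, for a
    fixed position [h] in the cube, let [b = a + r * h] be the point of the copy
    in that position. The weight factors as [prod_i nu_i (b_i)] times factors
    whose average over [r] is close to 1 for most [b]: this is a second moment
    computation ([weight_variance_cvg]), again an instance of the linear forms
    condition, with two parameters [r] and [r']. The set [A_n] enters this
    computation only as a bounded function of [b], so the estimate is uniform in
    [A_n]. Summing over [h], the weighted average over the copies of the density
    of [A_n] in the copy is, up to [o(1)], the weighted density of [A_n], whose
    upper limit is at least [delta]. Hence for every [K] there are
    arbitrarily large [n] and a copy of the cube of side [K + 1], inside the box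
    and with [1 <= r <= M_n], in which [A_n] has (unweighted) density at least
    [delta - 1 / (K + 1)] ([exists_dense_copy]).

    Pulled back to [Z^d], these sets have density about [delta] in larger and
    larger cubes, and Furstenberg's correspondence principle
    ([correspondence]) yields the system. The space is [{0, 1}^(Z^d)] with the
    shift action, [E] is the event that the origin is occupied, and the measure
    is a limit along a free ultrafilter of the laws of the sets seen from a
    random point of the cube. The limit is finitely additive on cylinders,
    extends to a probability measure because the space is compact
    ([cylinder_compact]), and is invariant because cubes are Folner sets
    ([sum_cube_shift]). A pattern of positive measure occurs in the sets, at a
    point of the cube, for infinitely many [K]. *)

(** * Probability measures from finitely additive means on cylinders *)

Definition config (G : Type) := G -> bool.
HB.instance Definition _ (G : Type) := Pointed.on (config G).

Section cylinders.
Variable G : eqType.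
Implicit Types (C D : set (config G)) (x y : config G) (s : seq G).

Definition cylinder C :=
  exists s, forall x y, {in s, x =1 y} -> C x -> C y.

Lemma cylinder0 : cylinder set0. Proof. by exists [::]. Qed.

Lemma cylinderU : setU_closed cylinder.
Proof.
move=> C D [s sC] [t tD]; exists (s ++ t) => x y xy [Cx|Dx].
- by left; apply: sC Cx => g gs; apply: xy; rewrite mem_cat gs.
- by right; apply: tD Dx => g gt; apply: xy; rewrite mem_cat gt orbT.
Qed.

Lemma cylinderC : setC_closed cylinder.
Proof.
move=> C [s sC]; exists s => x y xy nCx Cy; apply: nCx.
by apply: sC Cy => g /xy.
Qed.

Lemma free_ultrafilter : exists U : set_system nat, UltraFilter U /\ \oo `<=` U.
Proof. exact: (ultraFilterLemma eventually_filter). Qed.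

(** Compactness of the configuration space. If no finite subfamily covers [C],
    choose a point [x n] of [C] missed by the first [n] sets; the configuration
    [y] whose value at each [g] is the value of [x n g] for almost all [n], with
    respect to a free ultrafilter, agrees with almost every [x n] on any finite
    set of coordinates, so it lies in [C] and in none of the sets. *)
Lemma cylinder_compact (F : (set (config G))^nat) C :
  cylinder C -> (forall n, cylinder (F n)) -> C `<=` \bigcup_n F n ->
  exists n, C `<=` \bigcup_(i < n) F i.
Proof.
move=> [s sC] cF CF; apply: contrapT => noN.
have /choice[x xP] : forall n, exists x, C x /\ ~ (\bigcup_(i < n) F i) x.
  move=> n; apply: contrapT => nx; apply: noN; exists n => x Cx.
  by apply: contrapT => nFx; apply: nx; exists x.
have [U [UU sU]] := free_ultrafilter.
pose y : config G := fun g => `[< U [set n | x n g] >].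
have agree (t : seq G) : U [set n | {in t, x n =1 y}].
  elim: t => [|g t IH]; first by apply: filterS filterT.
  have Ug : U [set n | x n g = y g].
    rewrite /y; case: asboolP => [//|nUg].
    have [//|] := in_ultra_setVsetC [set n | x n g] UU.
    by apply: filterS => n /= /negP/negbTE.
  apply: filterS (filterI Ug IH) => n [/= xg xt] h.
  by rewrite inE => /orP[/eqP ->|/xt].
have [n yn] := filter_ex (agree s).
have [i _ Fiy] : (\bigcup_n F n) y by apply: CF; apply: sC yn _; case: (xP n).
have [t tF] := cF i.
have Ui : U [set n | (i < n)%N] by apply: sU; exists i.+1.
have [m [/= im xm]] := filter_ex (filterI Ui (agree t)).
case: (xP m) => _; apply; exists i => //; apply: tF Fiy => g gt.
by rewrite xm.
Qed.

End cylinders.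

Definition cylinder_display : Type -> measure_display.
Proof. by move=> _; exact: default_measure_display. Qed.

HB.instance Definition _ (G : eqType) :=
  @isAlgebraOfSets.Build (cylinder_display G) (config G) (@cylinder G)
    (@cylinder0 G) (@cylinderU G) (@cylinderC G).

(** Finitely additive probabilities defined on all subsets: total functions, so
    that ultrafilter limits of them can be taken without measurability. *)
Record finmean (R : realType) (T : Type) := FinMean {
  mean :> set T -> R;
  mean_ge0 : forall A, 0 <= mean A;
  meanU : forall A B, A `&` B = set0 -> mean (A `|` B) = mean A + mean B;
  meanT : mean setT = 1
}.

Section extension.
Context (R : realType) (G : eqType) (m : finmean R (config G)).

Definition cyl_content (A : set (config G)) : \bar R := (m A)%:E.

Let cyl_content_ge0 A : (0 <= cyl_content A)%E.
Proof. by rewrite lee_fin mean_ge0. Qed.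

Let mean0 : m set0 = 0.
Proof. by have := meanU m (setI0 set0); rewrite setU0; lra. Qed.

Let cyl_content_additive : measure_function.semi_additive cyl_content.
Proof.
by apply/additive2P => [|A B _ _ AB]; rewrite /cyl_content ?mean0 ?meanU.
Qed.

HB.instance Definition _ := isContent.Build (cylinder_display G) (config G) R
  cyl_content cyl_content_ge0 cyl_content_additive.

(** By compactness a countable cover of a cylinder by cylinders has a finite
    subcover, so finite additivity suffices. *)
Let cyl_content_sub : measurable_subset_sigma_subadditive cyl_content.
Proof.
move=> A F mF mA AF; have [n An] := cylinder_compact mA mF AF.
apply: (@le_trans _ _ (\sum_(i < n) cyl_content (F i))%E).
  by apply: content_subadditive => //; rewrite -bigcup_mkord.
rewrite -(big_mkord xpredT (fun i => cyl_content (F i))).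
exact: nneseries_lim_ge.
Qed.

HB.instance Definition _ := Content_SigmaSubAdditive_isMeasure.Build
  _ _ _ cyl_content cyl_content_sub.

Definition cyl_space := g_sigma_algebraType (@measurable _ (config G)).

Definition cyl_measure : set cyl_space -> \bar R :=
  measure_extension cyl_content.
HB.instance Definition _ := Measure.on cyl_measure.

Lemma cyl_measureE A : cylinder A -> cyl_measure A = (m A)%:E.
Proof.
by move=> cA; rewrite /cyl_measure /measure_extension measurable_mu_extE.
Qed.

Let cyl_measureT : cyl_measure setT = 1%E.
Proof. by rewrite cyl_measureE ?meanT//; exists [::]. Qed.

HB.instance Definition _ :=
  Measure_isProbability.Build _ _ _ cyl_measure cyl_measureT.
End extension.

Lemma cylinder_measurable_fun (G : eqType) (f : cyl_space G -> cyl_space G) :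
  (forall C, cylinder C -> cylinder (f @^-1` C)) -> measurable_fun setT f.
Proof.
move=> fC; refine (@measurability _ _ _ _ setT f (@cylinder G) _ _) => //.
by move=> _ [C cC <-]; rewrite setTI; apply: sub_sigma_algebra; exact: fC.
Qed.

(** The push-forward of the extension agrees with it on cylinders, so the
    uniqueness of the Caratheodory extension gives equality everywhere. *)
Lemma cyl_measure_invariant (R : realType) (G : eqType)
    (m : finmean R (config G)) (f : cyl_space G -> cyl_space G) :
  (forall C, cylinder C -> cylinder (f @^-1` C)) ->
  (forall C, cylinder C -> m (f @^-1` C) = m C) ->
  forall B, measurable B -> cyl_measure m (f @^-1` B) = cyl_measure m B.
Proof.
move=> fC fm B mB; have mf := cylinder_measurable_fun fC.
apply/esym; refine (@measure_extension_unique _ _ _ (cyl_content m) _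
  (pushforward (cyl_measure m) f) _ B mB).
  exists (fun=> setT); first by rewrite bigcup_const.
  by move=> i; split; [exact: measurableT|rewrite /= /cyl_content ltry].
by move=> C mC; rewrite /= /pushforward cyl_measureE ?fm//; exact: fC.
Unshelve. exact: mf.
Qed.

(** * Ultrafilter limits of empirical means *)

Lemma ultra_bounded_cvg (R : realType) (U : set_system nat) (u : nat -> R) :
  UltraFilter U -> (forall n, 0 <= u n <= 1) -> cvg (u n @[n --> U]).
Proof.
move=> UU u01.
have [|p [_ clp]] := @segment_compact R 0 1 (u n @[n --> U]) _.
  apply: (@filterS _ U _ setT); last exact: filterT.
  by move=> n _ /=; rewrite in_itv /=; exact: u01.
apply: (cvgP p) => V pV.
have [//|UnV] := in_ultra_setVsetC (u @^-1` V) UU.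
by have [x [nVx Vx]] := clp (~` V) V UnV pV.
Qed.

Section ultralimit.
Context (R : realType) (T : Type) (U : set_system nat) (UU : UltraFilter U).
Variable m : nat -> finmean R T.

Lemma finmean_le1 (p : finmean R T) A : p A <= 1.
Proof.
by rewrite -(meanT p) -(setUCr A) (meanU p (setICr A)) lerDl mean_ge0.
Qed.

Definition ulim_mean (A : set T) : R := lim (m n A @[n --> U]).

Lemma cvg_ulim_mean A : m n A @[n --> U] --> ulim_mean A.
Proof. by apply: ultra_bounded_cvg => n; rewrite mean_ge0 finmean_le1. Qed.

Lemma ulim_mean_ge0 A : 0 <= ulim_mean A.
Proof.
apply: limr_ge; first exact: cvg_ulim_mean.
by apply: filterS filterT => n _; exact: mean_ge0.
Qed.

Lemma ulim_meanU A B : A `&` B = set0 ->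
  ulim_mean (A `|` B) = ulim_mean A + ulim_mean B.
Proof.
move=> AB; apply: cvg_lim => //.
under eq_fun do rewrite meanU//.
by apply: cvgD; exact: cvg_ulim_mean.
Qed.

Lemma ulim_meanT : ulim_mean setT = 1.
Proof.
apply: cvg_lim => //; under eq_fun do rewrite meanT.
exact: cvg_cst.
Qed.

Definition ulim_finmean := FinMean ulim_mean_ge0 ulim_meanU ulim_meanT.
End ultralimit.

Section empirical.
Context (R : realType) (T : Type) (I : finType) (i0 : I) (x : I -> T).
Definition empirical (A : set T) : R := (\sum_i \1_A (x i)) / #|I|%:R.

Let card_gt0 : 0 < #|I|%:R :> R.
Proof. by rewrite ltr0n; apply/card_gt0P; exists i0. Qed.

Lemma empirical_ge0 A : 0 <= empirical A.
Proof. by rewrite divr_ge0// sumr_ge0. Qed.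

Lemma empiricalU A B : A `&` B = set0 ->
  empirical (A `|` B) = empirical A + empirical B.
Proof.
move=> AB; rewrite /empirical -mulrDl -big_split/=; congr (_ / _).
apply: eq_bigr => i _; rewrite !indicE in_setU.
case: (boolP (x i \in A)) => [iA|]; case: (boolP (x i \in B)) => [iB|] //=;
  rewrite ?addr0 ?add0r//.
by have := conj (set_mem iA) (set_mem iB) : (A `&` B) (x i); rewrite AB.
Qed.

Lemma empiricalT : empirical setT = 1.
Proof.
rewrite /empirical; under eq_bigr do rewrite indicE in_setT.
by rewrite sumr_const cardT -cardE divff// gt_eqF.
Qed.

Definition empirical_mean := FinMean empirical_ge0 empiricalU empiricalT.
End empirical.

(** * Folner property of cubes *)

Section cube.
Context (R : realType) (d : nat).

(** The cube [{0, ..., K}^d]: side [K.+1], so that it is never empty. *)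
Definition cube (K : nat) := {ffun 'I_d -> 'I_K.+1}.
Definition cube_pt K (h : cube K) : 'rV[int]_d := \row_i (h i : nat)%:Z.

Lemma card_ord_shift (K : nat) (v : int) :
  (K.+1 - `|v| <= #|[pred x : 'I_K.+1 | (0 <= x%:Z - v < K.+1%:Z)%R]|)%N.
Proof.
set S := [pred x | _].
have [vK|vK] := leqP K.+1 `|v|%N.
  by move: vK; rewrite -subn_eq0 => /eqP ->.
(* The admissible range is [v, K] for v >= 0 and [0, K + v] for v < 0. *)
pose f (y : 'I_(K.+1 - `|v|)%N) : 'I_K.+1 :=
  inord (if (0 <= v)%R then y + `|v| else y)%N.
have fE y : f y = (if (0 <= v)%R then y + `|v| else y)%N :> nat.
  by rewrite inordK//; case: ifP => _; have := ltn_ord y; lia.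
have finj : injective f.
  move=> y z /(congr1 val) /=; rewrite !fE => yz; apply: val_inj.
  by move: yz; case: ifP => _ /=; lia.
rewrite -[leqLHS]card_ord -(card_imset _ finj); apply: subset_leq_card.
apply/fintype.subsetP => _ /imsetP[y _ ->]; rewrite inE fE.
by have := ltn_ord y; case: ifP; lia.
Qed.

(** A lower bound for the proportion of the points [h] of the cube such that
    [h - v] stays in the cube. *)
Definition folner_ratio (v : 'rV[int]_d) (K : nat) : R :=
  \prod_(i < d) ((K.+1 - `|v ord0 i|)%N%:R / K.+1%:R).

Lemma folner_ratio_cvg v : folner_ratio v K @[K --> \oo] --> (1 : R).
Proof.
rewrite [X in _ --> X](_ : 1 = \prod_(i < d) 1); last by rewrite big1.
apply: (cvg_big (@mul_continuous R)) => i _.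
have : (1 - `|v ord0 i|%N%:R * (K.+1%:R)^-1) @[K --> \oo] --> (1 : R).
  rewrite -[X in _ --> X]subr0; apply: cvgB; first exact: cvg_cst.
  rewrite -[X in _ --> X](mulr0 `|v ord0 i|%N%:R); apply: cvgM.
    exact: cvg_cst.
  exact: cvg_harmonic.
apply: cvg_trans; apply: near_eq_cvg; near=> K.
have vK : (`|v ord0 i| <= K.+1)%N by apply: leqW; near: K; exact: nbhs_infty_ge.
by rewrite natrB// mulrBl divff// pnatr_eq0.
Unshelve. all: by end_near. Qed.

(** Translation sends the points whose translate stays in the cube injectively
    into the cube; the remaining points contribute at most 1 each. *)
Lemma sum_cube_shift K (F : 'rV[int]_d -> R) v : (forall u, 0 <= F u <= 1) ->
  \sum_(h : cube K) F (cube_pt h - v) <=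
  \sum_(h : cube K) F (cube_pt h) + (1 - folner_ratio v K) * #|cube K|%:R.
Proof.
move=> F01.
pose S i := [pred x : 'I_K.+1 | 0 <= x%:Z - v ord0 i < K.+1%:Z].
pose good : pred (cube K) := family S.
pose f (h : cube K) : cube K := [ffun i => inord `|(h i)%:Z - v ord0 i|%N].
have fE h : good h -> cube_pt (f h) = cube_pt h - v.
  move=> /familyP gh; apply/rowP => i; rewrite !mxE ffunE.
  have := gh i; rewrite inE => /andP[ge0 ltK].
  by rewrite inordK ?gez0_abs // -ltz_nat gez0_abs.
have finj : {in good &, injective f}.
  move=> x y gx gy ff; apply/ffunP => i; apply: val_inj.
  have := fE x gx; rewrite ff fE// => /rowP /(_ i); rewrite !mxE.
  by move=> /(congr1 (+%R^~ (v ord0 i))); rewrite !subrK => -[].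
have good_card : folner_ratio v K * #|cube K|%:R <= #|good|%:R.
  rewrite /good card_family foldrE big_map big_enum /=.
  rewrite card_ffun !card_ord natr_prod natrX /folner_ratio.
  rewrite -[in X in _ * X](card_ord d) -prodr_const -big_split/=.
  apply: ler_prod => i _; rewrite divfK ?pnatr_eq0// ler0n ler_nat.
  exact: card_ord_shift.
rewrite (bigID good)/=; apply: lerD.
  rewrite (eq_bigr (fun h => F (cube_pt (f h)))); last by move=> h /fE ->.
  rewrite -(big_imset (fun h => F (cube_pt h)))//=.
  rewrite [leRHS](bigID (mem (f @: good)))/= lerDl sumr_ge0// => h _.
  by case/andP: (F01 (cube_pt h)).
apply: (@le_trans _ _ (\sum_(h : cube K | ~~ good h) 1)).
  by apply: ler_sum => h _; case/andP: (F01 (cube_pt h - v)).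
rewrite mulrBl mul1r sumr_const lerBrDr.
by rewrite -[in leRHS](cardC good) natrD addrC lerD.
Qed.
End cube.

(** * The correspondence principle *)

Section shift.
Context (d : nat).
Let G := 'rV[int]_d.

(** The sign is chosen so that [shift v] maps the configurations occupied at [0]
    onto those occupied at [v]. *)
Definition shift (v : G) (y : cyl_space G) : cyl_space G := fun g => y (g - v).

Lemma shiftD v w : shift (v + w) = shift v \o shift w.
Proof. by apply/funext => y; apply/funext => g; rewrite /shift /= opprD addrA. Qed.

Lemma shift0 : shift 0 = id.
Proof. by apply/funext => y; apply/funext => g; rewrite /shift subr0. Qed.

Lemma shiftK v : cancel (shift v) (shift (- v)).
Proof.
by move=> y; rewrite -[LHS]/((shift (- v) \o shift v) y) -shiftD addNr shift0.
Qed.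

Lemma shift_bij v : bijective (shift v).
Proof. by exists (shift (- v)); [|rewrite -{2}(opprK v)]; exact: shiftK. Qed.

Lemma cylinder_shift v C : cylinder C -> cylinder (shift v @^-1` C).
Proof.
move=> [s sC]; exists [seq g - v | g <- s] => y z yz; apply: sC => g gs.
by apply: yz; exact: map_f.
Qed.

Lemma image_shift v C : shift v @` C = shift (- v) @^-1` C.
Proof.
apply/seteqP; split => [_ [y Cy <-]|y Cy]; first by rewrite /= shiftK.
by exists (shift (- v) y) => //; rewrite -{1}(opprK v) shiftK.
Qed.
End shift.

Section correspondence.
Context (R : realType) (d : nat).
Let G := 'rV[int]_d.
Variable x : nat -> config G.

(** The configuration [x K] seen from the point [h]; averaging over [h] in a
    large cube makes its law almost invariant under shifts. *)
Definition window K (h : cube d K) : config G := fun g => x K (cube_pt h + g).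

Definition window_mean K : finmean R (config G) :=
  empirical_mean R [ffun=> ord0] (@window K).

Lemma window_mean_shift K v C :
  window_mean K (shift v @^-1` C) <= window_mean K C + (1 - folner_ratio R v K).
Proof.
rewrite /= /empirical.
have cK : 0 < #|cube d K|%:R :> R.
  by rewrite ltr0n; apply/card_gt0P; exists [ffun=> ord0].
rewrite ler_pdivrMr// mulrDl divfK ?gt_eqF//.
pose F u : R := \1_C (fun g => x K (u + g)).
have F01 u : 0 <= F u <= 1.
  by rewrite /F indicE; case: (_ \in _); rewrite ?lexx ?ler01.
apply: le_trans (sum_cube_shift K v F01); apply: ler_sum => h _.
rewrite /F !indicE.
suff -> : (@window K h \in shift v @^-1` C) =
          ((fun g => x K (cube_pt h - v + g)) \in C) by [].
rewrite /in_mem /= /in_set; congr `[< C _ >].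
by apply/funext => g; rewrite /shift /window addrAC addrA.
Qed.

Context (U : set_system nat) (UU : UltraFilter U) (sU : \oo `<=` U).

Let m := ulim_finmean UU window_mean.

(** The one-sided estimates for [v] and for [- v] give equality in the limit. *)
Lemma ulim_window_shift v C : m (shift v @^-1` C) = m C.
Proof.
have cm D : window_mean K D @[K --> U] --> m D by exact: cvg_ulim_mean.
have le w D : m (shift w @^-1` D) <= m D.
  have e0 : window_mean K D + (1 - folner_ratio R w K) @[K --> U] --> m D.
    rewrite -[X in _ --> X]addr0; apply: cvgD; first exact: cm.
    rewrite -(subrr 1); apply: cvgB; first exact: cvg_cst.
    by move=> V /(@folner_ratio_cvg R d w) /sU.
  apply: (ler_cvg_to (cm _) e0).
  by apply: filterS filterT => K _; exact: window_mean_shift.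
apply/eqP; rewrite eq_le le /=.
rewrite [leLHS](_ : _ = m (shift (- v) @^-1` (shift v @^-1` C))); first exact: le.
congr (m _); rewrite -comp_preimage -shiftD addrN shift0.
by [].
Qed.

End correspondence.

(** Furstenberg's correspondence: [mu] is the limit law of the configurations
    [x K] seen from a uniformly random point of the cube of side [K.+1]. An event that only
    involves finitely many coordinates and has positive limit probability occurs
    in the [K]-th law for infinitely many [K]. *)
Lemma correspondence (R : realType) (d : nat) (x : nat -> config 'rV[int]_d)
    (delta : R) :
  (forall K, delta - K.+1%:R^-1 <=
     (\sum_(h : cube d K) (x K (cube_pt h))%:R) / #|cube d K|%:R) ->
  exists (disp : measure_display) (X : measurableType disp)
         (mu : probability X R) (T : 'rV[int]_d -> X -> X) (E : set X),
    [/\ is_Zd_system mu T, measurable E, (delta%:E <= mu E)%E &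
        forall (k : nat) (h : 'I_k -> 'rV[int]_d),
          (0 < mu (\bigcap_(j in [set: 'I_k]) (T (h j) @` E)))%E ->
          forall K0, exists2 K, (K0 <= K)%N &
            exists g : cube d K, forall j, x K (cube_pt g + h j)].
Proof.
move=> dens; have [U [UU sU]] := free_ultrafilter.
pose m := ulim_finmean UU (window_mean R x).
have cm D : window_mean R x K D @[K --> U] --> m D.
  exact: cvg_ulim_mean.
have muE C : cylinder C ->
    (cyl_measure m : probability (cyl_space 'rV[int]_d) R) C = (m C)%:E.
  exact: cyl_measureE.
pose E : set (cyl_space 'rV[int]_d) := [set y | y 0].
have cE v : cylinder [set y : config 'rV[int]_d | y v].
  by exists [:: v] => y z yz /=; rewrite yz// inE.
exists _, (cyl_space 'rV[int]_d), (cyl_measure m), (@shift d), E.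
have imE v : shift v @` E = [set y | y v].
  rewrite image_shift; apply/seteqP; split => y /=;
    by rewrite /E/= /shift opprK add0r.
split.
- split; [exact: shift_bij| | |exact: shiftD].
  + by move=> v; apply: cylinder_measurable_fun => C; exact: cylinder_shift.
  + move=> v; apply: cyl_measure_invariant => C cC; first exact: cylinder_shift.
    exact: ulim_window_shift.
- by apply: sub_sigma_algebra; exact: cE.
- rewrite muE; last exact: cE.
  rewrite lee_fin.
  have d0 : delta - K.+1%:R^-1 @[K --> U] --> delta.
    rewrite -[X in _ --> X]subr0; apply: cvgB; first exact: cvg_cst.
    by move=> V /(@cvg_harmonic R) /sU.
  apply: (ler_cvg_to d0 (cm _)).
  apply: filterS filterT => K _; apply: le_trans (dens K) _.
  rewrite /= /empirical ler_wpM2r ?invr_ge0//; apply: ler_sum => h _.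
  rewrite indicE; case: (boolP (x K _)) => [xh|_]; last by rewrite ler0n.
  by rewrite mem_set// /E/= /window addr0.
- move=> k h; under eq_bigcapr do rewrite imE.
  rewrite muE; last first.
    exists (codom h) => y z yz /= yP j _.
    by rewrite -yz ?codom_f//; exact: yP.
  rewrite lte_fin => m_gt0 K0.
  have UK0 : U [set K | (K0 <= K)%N] by apply: sU; exists K0.
  have [K [/= K0K]] :=
    filter_ex (filterI UK0 (cvgr_gt _ (cm _) _ m_gt0)).
  move=> K_gt0; exists K => //; apply: contrapT => nog.
  move: K_gt0; rewrite /= /empirical big1 ?mul0r ?ltxx// => g _.
  rewrite indicE memNset// => gP; apply: nog; exists g => j; exact: gP.
Qed.

(** * Averages over finite sets *)

Section avg.
Context (R : realType).

Lemma avgD (I : choiceType) (S : set I) (f g : I -> R) :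
  avg S (fun a => f a + g a) = avg S f + avg S g.
Proof. by rewrite /avg big_split mulrDl. Qed.

Lemma avgZ (I : choiceType) (S : set I) (c : R) (f : I -> R) :
  avg S (fun a => c * f a) = c * avg S f.
Proof. by rewrite /avg -big_distrr mulrA. Qed.

Lemma avg_sum (I : choiceType) (S : set I) (J : finType) (f : J -> I -> R) :
  avg S (fun a => \sum_j f j a) = \sum_j avg S (f j).
Proof. by rewrite /avg exchange_big -big_distrl. Qed.

Lemma ler_avg (I : choiceType) (S : set I) (f g : I -> R) : finite_set S ->
  (forall a, S a -> f a <= g a) -> avg S f <= avg S g.
Proof.
move=> fS fg; rewrite /avg ler_wpM2r ?invr_ge0//.
rewrite big_seq [leRHS]big_seq; apply: ler_sum => a.
by rewrite in_fset_set// inE; exact: fg.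
Qed.

Lemma eq_avg (I : choiceType) (S : set I) (f g : I -> R) : finite_set S ->
  (forall a, S a -> f a = g a) -> avg S f = avg S g.
Proof. by move=> fS fg; apply/eqP; rewrite eq_le !ler_avg// => a /fg ->. Qed.

Lemma avgE (I : choiceType) (S : set I) (f : I -> R) : finite_set S ->
  avg S f = (\sum_(a \in S) f a) / (\sum_(a \in S) (1 : R)).
Proof.
move=> fS; rewrite !fsbig_finite// /avg; congr (_ / _).
by rewrite big_const_seq count_predT iter_addr_0.
Qed.

Lemma avg_cst (I : choiceType) (S : set I) (c : R) : finite_set S -> S !=set0 ->
  avg S (fun=> c) = c.
Proof.
move=> fS S0; rewrite /avg big_const_seq count_predT iter_addr_0.
rewrite -[c *+ _]mulr_natr mulfK//.
rewrite pnatr_eq0 cardfs_eq0; apply: contraPneq S0 => /(fset_set_set0 fS) ->.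
by case.
Qed.

Lemma avg_reindex (I J : choiceType) (P : set I) (Q : set J) (h : I -> J)
    (f : J -> R) : finite_set P -> set_bij P Q h ->
  avg Q f = avg P (f \o h).
Proof.
move=> fP hPQ; have fQ : finite_set Q.
  by have [_ _ /(sub_finite_set)] := hPQ; apply; exact: finite_image.
by rewrite !avgE// (reindex_fsbig h P Q f)// (reindex_fsbig h P Q (fun=> 1 : R)).
Qed.

Lemma avg_pair (I J : choiceType) (P : set I) (Q : set J) (f : I * J -> R) :
  finite_set P -> finite_set Q ->
  avg (P `*` Q) f = avg P (fun p => avg Q (fun q => f (p, q))).
Proof.
move=> fP fQ; have fPQ : finite_set (P `*` Q) by exact: finite_setX.
pose cQ : R := \sum_(q \in Q) (1 : R).
have sum1 : \sum_(p \in P `*` Q) (1 : R) = cQ * \sum_(p \in P) (1 : R).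
  rewrite -(pair_fsbig _ (fun (_ : I) (_ : J) => 1 : R))// mulr_fsumr.
  by apply: eq_fsbigr => p _; rewrite mulr1.
rewrite !avgE// sum1 invfM mulrA; congr (_ / _).
rewrite mulr_fsuml; transitivity (\sum_(p \in P `*` Q) f (p.1, p.2) / cQ).
  by apply: eq_fsbigr => -[].
rewrite -(pair_fsbig _ (fun p q => f (p, q) / cQ))//.
by apply: eq_fsbigr => p _; rewrite avgE// mulr_fsuml.
Qed.

Lemma exchange_avg (I J : choiceType) (P : set I) (Q : set J) (f : I -> J -> R) :
  avg P (fun p => avg Q (f p)) = avg Q (fun q => avg P (f^~ q)).
Proof. by rewrite /avg -!mulr_suml exchange_big mulrAC. Qed.
End avg.

(** * The linear forms condition with two parameters *)

Section boxes.
Context (R : realType).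

Lemma finite_box m (L : 'I_m -> R) : finite_set (box L).
Proof.
pose K := \sum_l (Num.truncn (L l)).+1.
apply: (@sub_finite_set _ _ (range (@cube_pt m K))); last first.
  by apply: finite_image; exact: finite_finset.
move=> r rL; exists [ffun l => inord `|r ord0 l|%N] => //.
apply/rowP => l; rewrite mxE ffunE inordK.
  by rewrite gez0_abs //; case: (rL l); lia.
have [r1 rl] := rL l.
have r0 : 0 <= r ord0 l by lia.
have : (`|r ord0 l|%N%:R : R) <= L l.
  by move: rl; rewrite -{1}(gez0_abs r0) -pmulrn.
move=> rl'; rewrite ltnS.
apply: (@leq_trans (Num.truncn (L l)).+1).
  apply: ltnW; rewrite -(ltr_nat R); apply: le_lt_trans rl' _.
  exact: truncnS_gt.
by rewrite /K (bigD1 l)//= leq_addr.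
Qed.

Lemma finite_intvl (x : R) : finite_set (intvl x).
Proof.
apply: (@sub_finite_set _ _ ((fun r : 'rV[int]_1 => r ord0 ord0) @`
  box (fun _ : 'I_1 => x))).
  move=> r xr; exists (const_mx r); last by rewrite mxE.
  by move=> l; rewrite mxE.
by apply: finite_image; exact: finite_box.
Qed.

Lemma intvl_neq0 (x : R) : 1 <= x -> intvl x !=set0.
Proof. by move=> x1; exists 1; split. Qed.

Lemma avg_box2 (x : R) (f : 'rV[int]_2 -> R) :
  avg (box (fun _ : 'I_2 => x)) f =
  avg (intvl x) (fun r => avg (intvl x) (fun s =>
    f (\row_l (if l == 0 then r else s)))).
Proof.
have fI := finite_intvl x.
rewrite (@avg_reindex _ _ _ (intvl x `*` intvl x) _
  (fun p : int * int => \row_l (if l == 0 then p.1 else p.2))).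
- by rewrite avg_pair.
- exact: finite_setX.
- split.
  + by move=> [r s] [/= xr xs] l; rewrite mxE; case: ifP.
  + move=> [r s] [r' s'] _ _ /rowP e; move: (e 0) (e 1); rewrite !mxE /=.
    by move=> -> ->.
  + move=> r rx; exists (r ord0 0, r ord0 1); first by split; exact: rx.
    apply/rowP => l; rewrite mxE; case: ifPn => [/eqP ->//|l0] /=.
    by congr (r _ _); apply: val_inj; case: l l0 => -[|[|]].
Qed.
End boxes.

Section lfc2.
Context (R : realType) (d : nat) (N : nat -> nat) (M : nat -> R).
Variable nu : nat -> 'I_d -> int -> R.
Hypothesis M_ge1 : forall n, 1 <= M n.
Hypothesis nu_lfc : linear_forms_condition N M nu.

Let bx n := box (fun _ : 'I_d => (N n)%:R : R).
Let w n i := extend0 (N n) (nu n i).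

(** The linear forms condition for two parameters [r] and [s], both ranging over
    [intvl (M n)], and for each coordinate a duplicate-free list of forms
    [c.1 * r + c.2 * s]. Two parameters are what a second moment requires. The
    choice [L = M] is legitimate since [H n <= M n] for large [n]. *)
Lemma lfc_pairs (S : 'I_d -> seq (int * int)) : (forall i, uniq (S i)) ->
  avg (bx n) (fun a => avg (intvl (M n)) (fun r => avg (intvl (M n)) (fun s =>
    \prod_(i < d) \prod_(c <- S i) w n i (a ord0 i + (c.1 * r + c.2 * s)))))
  @[n --> \oo] --> (1 : R).
Proof.
move=> uS.
pose row2 (p : int * int) : 'rV[int]_2 := \row_l (if l == 0 then p.1 else p.2).
have row2_inj : injective row2.
  by move=> [r s] [r' s'] /rowP e; move: (e 0) (e 1); rewrite !mxE /= => -> ->.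
pose phi i (j : 'I_(size (S i))) := row2 (tnth (in_tuple (S i)) j).
have phi_inj i : injective (phi i).
  by move=> j k /row2_inj /tuple_uniqP; apply; exact: uS.
have [H [HM lfc]] := nu_lfc phi_inj.
have L1 : forall n (l : 'I_2), 1 <= M n by move=> n _; exact: M_ge1.
have HL : \forall n \near \oo, forall l : 'I_2, H n <= M n <= M n.
  near=> n => _; rewrite lexx andbT.
  have Mn : 0 < M n by apply: lt_le_trans (M_ge1 n).
  rewrite -[leRHS]mul1r -ler_pdivrMr//; near: n.
  exact: (cvgr_le _ HM _ ltr01).
have := lfc (fun n _ => M n) L1 HL.
apply: cvg_trans; apply: near_eq_cvg; near=> n.
apply: eq_avg => [|a an]; first exact: finite_box.
rewrite avg_box2; apply: eq_avg => [|r rn]; first exact: finite_intvl.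
apply: eq_avg => [|s sn]; first exact: finite_intvl.
apply: eq_bigr => i _; rewrite (big_tnth _ _ (S i)); apply: eq_bigr => j _.
by rewrite /linform !big_ord_recl big_ord0 !mxE /= addr0.
Unshelve. all: by end_near. Qed.
End lfc2.

(** * Dense homothetic copies of a cube *)

Lemma limn_esup_le_near (R : realType) (u : nat -> \bar R) (l : \bar R) :
  (\forall n \near \oo, (u n <= l)%E) -> (limn_esup u <= l)%E.
Proof.
move=> ul; rewrite /limn_esup limf_esupE.
apply: (@le_trans _ _ (ereal_sup (u @` [set n | (u n <= l)%E]))).
  by apply: ereal_inf_lbound; exists [set n | (u n <= l)%E].
by apply: ge_ereal_sup => _ [n ? <-].
Qed.

Section patterns.
Context (R : realType) (d : nat) (N : nat -> nat) (M : nat -> R).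
Variable nu : nat -> 'I_d -> int -> R.
Hypothesis M_ge1 : forall n, 1 <= M n.
Hypothesis nu_ge0 : forall n i (x : int), 1 <= x <= (N n)%:Z -> 0 <= nu n i x.
Hypothesis nu_lfc : linear_forms_condition N M nu.

Let bx n := box (fun _ : 'I_d => (N n)%:R : R).
Let w n i := extend0 (N n) (nu n i).
Variable K : nat.

(** The weight of the copy [a + r * {0, ..., K}^d]: the points of this copy have
    [i]-th coordinates [a_i + x * r] with [0 <= x <= K], and each of these values
    is counted once. It vanishes unless the whole copy lies in the box. *)
Definition weight n (a : 'rV[int]_d) (r : int) : R :=
  \prod_(i < d) \prod_(x < K.+1) w n i (a ord0 i + x%:Z * r).

Definition base_weight n (b : 'rV[int]_d) : R := \prod_(i < d) w n i (b ord0 i).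

(** The factors of the weight other than those of the base point, for a copy in
    which the base point [b] occupies position [h]. *)
Definition others n (h : cube d K) (b : 'rV[int]_d) (r : int) : R :=
  \prod_(i < d) \prod_(x < K.+1 | x != h i)
    w n i (b ord0 i + (x%:Z - (h i)%:Z) * r).

Definition avg_others n h b : R := avg (intvl (M n)) (others n h b).

Lemma w_ge0 n i x : 0 <= w n i x.
Proof. by rewrite /w /extend0; case: ifP => // /nu_ge0. Qed.

Lemma weight_ge0 n a r : 0 <= weight n a r.
Proof. by apply: prodr_ge0 => i _; apply: prodr_ge0 => x _; exact: w_ge0. Qed.

Lemma base_weight_ge0 n b : 0 <= base_weight n b.
Proof. by apply: prodr_ge0 => i _; exact: w_ge0. Qed.

Lemma weight_shift n (h : cube d K) b r :
  weight n (b - r *: cube_pt h) r = base_weight n b * others n h b r.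
Proof.
rewrite -big_split; apply: eq_bigr => i _; rewrite (bigD1 (h i))//=.
rewrite !mxE [r * _]mulrC subrK; congr (_ * _).
by apply: eq_bigr => x _; rewrite mulrBl addrA addrAC.
Qed.

Lemma intvlNE n k : intvl ((N n)%:R : R) k <-> 1 <= k <= (N n)%:Z.
Proof.
rewrite /intvl /= pmulrn ler_int; split => [[-> ->]//|/andP[]//].
Qed.

Lemma weight_supp n a r (h : cube d K) :
  weight n a r != 0 -> bx n (a + r *: cube_pt h).
Proof.
move=> /prodf_neq0 /= wn i; have /prodf_neq0 /(_ (h i) isT) := wn i isT.
rewrite /w /extend0; case: ifP => [xN _|]; last by rewrite eqxx.
by apply/intvlNE; rewrite !mxE mulrC.
Qed.

Definition diffs (h : cube d K) i : seq int :=
  [seq x%:Z - (h i)%:Z | x : 'I_K.+1 <- enum 'I_K.+1 & x != h i].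

Lemma prod_diffs h i (F : int -> R) :
  \prod_(y <- diffs h i) F y = \prod_(x < K.+1 | x != h i) F (x%:Z - (h i)%:Z).
Proof. by rewrite big_map big_filter big_enum_cond. Qed.

Lemma uniq_diffs h i : uniq (diffs h i).
Proof.
rewrite map_inj_uniq; first by apply: filter_uniq; exact: enum_uniq.
move=> x y.
by move=> /(congr1 (+%R^~ (h i)%:Z)); rewrite !subrK => -[/val_inj].
Qed.

Lemma diffs_neq0 h i y : y \in diffs h i -> y != 0.
Proof.
move=> /mapP[x]; rewrite mem_filter => /andP[xh _] ->.
by apply: contra xh; rewrite subr_eq0 => /eqP[/val_inj ->].
Qed.

Let J n := intvl (M n).

Lemma avgJ_cst n (c : R) : avg (J n) (fun=> c) = c.
Proof. by apply: avg_cst; [exact: finite_intvl|exact: intvl_neq0]. Qed.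

Lemma base_weight_cvg : avg (bx n) (base_weight n) @[n --> \oo] --> (1 : R).
Proof.
have := @lfc_pairs _ _ _ _ _ M_ge1 nu_lfc (fun=> [:: (0, 0)]) (fun=> isT).
apply: cvg_trans; apply: near_eq_cvg; apply: nearW => n.
apply: eq_avg => [|a _]; first exact: finite_box.
do 2 rewrite -(avgJ_cst n (base_weight n a)).
do 2 (apply: eq_avg => [|? _]; first exact: finite_intvl).
by apply: eq_bigr => i _; rewrite big_seq1 !mul0r !addr0.
Qed.

Lemma first_moment_cvg h :
  avg (bx n) (fun b => base_weight n b * avg_others n h b) @[n --> \oo]
    --> (1 : R).
Proof.
have uS i : uniq ((0, 0) :: [seq (y, 0 : int) | y <- diffs h i]).
  rewrite /= map_inj_uniq ?uniq_diffs ?andbT//; last by move=> y z [].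
  by apply/mapP => -[y /diffs_neq0/eqP y0 [] /esym /y0].
have := @lfc_pairs _ _ _ _ _ M_ge1 nu_lfc _ uS.
apply: cvg_trans; apply: near_eq_cvg; apply: nearW => n.
apply: eq_avg => [|a _]; first exact: finite_box.
rewrite -avgZ; apply: eq_avg => [|r _]; first exact: finite_intvl.
rewrite -[RHS](avgJ_cst n); apply: eq_avg => [|s _]; first exact: finite_intvl.
rewrite -big_split; apply: eq_bigr => i _.
rewrite big_cons !mul0r !addr0 big_map prod_diffs; congr (_ * _).
by apply: eq_bigr => x _ /=; rewrite mul0r addr0.
Qed.

(** The square of an average over [r] is an average over pairs [(r, s)], and the
    forms [0], [y * r] and [y * s] are pairwise distinct because [y] ranges over
    nonzero differences. *)
Lemma second_moment_cvg h :
  avg (bx n) (fun b => base_weight n b * avg_others n h b ^+ 2) @[n --> \oo]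
    --> (1 : R).
Proof.
have uS i : uniq ((0, 0) :: [seq (y, 0 : int) | y <- diffs h i] ++
                            [seq (0 : int, y) | y <- diffs h i]).
  have u1 : uniq [seq (y, 0 : int) | y <- diffs h i].
    by rewrite map_inj_uniq ?uniq_diffs// => y z [].
  have u2 : uniq [seq (0 : int, y) | y <- diffs h i].
    by rewrite map_inj_uniq ?uniq_diffs// => y z [].
  rewrite cons_uniq cat_uniq u1 u2 mem_cat negb_or andbT.
  apply/andP; split; first (apply/andP; split).
  - by apply/mapP => -[y /diffs_neq0/eqP y0 [] /esym /y0].
  - by apply/mapP => -[y /diffs_neq0/eqP y0 [] /esym /y0].
  - apply/hasPn => _ /mapP[y /diffs_neq0/eqP y0 ->].
    by apply/mapP => -[z _ [_ /y0]].
have := @lfc_pairs _ _ _ _ _ M_ge1 nu_lfc _ uS.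
apply: cvg_trans; apply: near_eq_cvg; apply: nearW => n.
apply: eq_avg => [|a _]; first exact: finite_box.
rewrite expr2 mulrA [RHS]mulrC -!avgZ.
apply: eq_avg => [|r _]; first exact: finite_intvl.
rewrite mulrC -mulrA mulrCA -avgZ -avgZ.
apply: eq_avg => [|s _]; first exact: finite_intvl.
rewrite mulrA -!big_split; apply: eq_bigr => i _ /=.
rewrite big_cons big_cat (big_map (fun y => (y, 0 : int))).
rewrite (big_map (fun y => (0 : int, y))) !prod_diffs !mul0r !addr0 -mulrA.
by rewrite [RHS]mulrCA; congr (_ * (_ * _)); apply: eq_bigr => x _;
  rewrite /= ?addr0 ?add0r.
Qed.

Definition weight_variance n h : R :=
  avg (bx n) (fun b => base_weight n b * (avg_others n h b - 1) ^+ 2).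

(** For most base points, in the sense of [base_weight], the average over [r] of
    the remaining factors is close to 1: the moments of order 0, 1 and 2 all tend
    to 1, and the variance to [1 - 2 + 1]. *)
Lemma weight_variance_cvg h : weight_variance n h @[n --> \oo] --> (0 : R).
Proof.
have -> : (fun n => weight_variance n h) = (fun n =>
    avg (bx n) (fun b => base_weight n b * avg_others n h b ^+ 2) +
    (- 2 * avg (bx n) (fun b => base_weight n b * avg_others n h b) +
    avg (bx n) (base_weight n))).
  apply/funext => n; rewrite -avgZ -!avgD.
  by apply: eq_avg => [|b _]; [exact: finite_box|ring].
rewrite (_ : (0 : R) = 1 + (- 2 * 1 + 1)); last by ring.
apply: cvgD; first exact: second_moment_cvg.
apply: cvgD; last exact: base_weight_cvg.
by apply: cvgM; [exact: cvg_cst|exact: first_moment_cvg].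
Qed.

(** Seen from the corner of the copy, the weight is [base_weight] times the other
    factors, so this is a first moment. *)
Lemma weight_cvg :
  avg (J n) (fun r => avg (bx n) (fun a => weight n a r)) @[n --> \oo]
    --> (1 : R).
Proof.
have := first_moment_cvg [ffun=> ord0].
apply: cvg_trans; apply: near_eq_cvg; apply: nearW => n.
rewrite -exchange_avg; apply: eq_avg => [|b _]; first exact: finite_box.
rewrite -avgZ; apply: eq_avg => [|r _]; first exact: finite_intvl.
rewrite -weight_shift; congr (weight n _ r).
by apply/rowP => i; rewrite !mxE ffunE mulr0 subr0.
Qed.

Variable A : nat -> set 'rV[int]_d.
Hypothesis A_sub : forall n, A n `<=` bx n.

(** Replacing [a] by [b - r *: cube_pt h] does not change the box of summation,
    because the summands vanish outside it: no error is made at the boundary. *)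
Lemma sum_weight_shift n r (h : cube d K) :
  \sum_(a \in bx n) weight n a r * \1_(A n) (a + r *: cube_pt h) =
  \sum_(b \in bx n) weight n (b - r *: cube_pt h) r * \1_(A n) b.
Proof.
pose F a := weight n a r * \1_(A n) (a + r *: cube_pt h).
rewrite (fsbig_widen (bx n) setT F)//; last first.
  move=> a [_ na] /=; rewrite /F; apply/eqP; rewrite mulf_eq0; apply/orP; left.
  apply/negPn/negP => /(weight_supp [ffun=> ord0]) /=.
  rewrite (_ : cube_pt _ = 0) ?scaler0 ?addr0//.
  by apply/rowP => i; rewrite !mxE ffunE.
rewrite (fsbig_widen (bx n) setT)//; last first.
  by move=> b [_ nb] /=; rewrite indicE memNset ?mulr0// => /A_sub.
rewrite (reindex_fsbigT (fun b => b - r *: cube_pt h))/=.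
  by apply: eq_fsbigr => b _; rewrite /F subrK.
by exists (fun b => b + r *: cube_pt h) => b; rewrite ?subrK ?addrK.
Qed.

Definition density n (a : 'rV[int]_d) (r : int) : R :=
  (\sum_(h : cube d K) \1_(A n) (a + r *: cube_pt h)) / #|cube d K|%:R.

(** Averaging the density of [A] over all weighted copies amounts to averaging,
    for each position [h], over the points [b] of [A] that occupy it. *)
Lemma avg_weight_density n :
  avg (J n) (fun r => avg (bx n) (fun a => weight n a r * density n a r)) =
  (\sum_(h : cube d K)
     avg (bx n) (fun b => \1_(A n) b * (base_weight n b * avg_others n h b)))
  / #|cube d K|%:R.
Proof.
have fB : finite_set (bx n) by exact: finite_box.
have fJ : finite_set (J n) by exact: finite_intvl.
transitivity (avg (J n) (fun r => \sum_(h : cube d K) #|cube d K|%:R^-1 *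
    avg (bx n) (fun b => \1_(A n) b * (base_weight n b * others n h b r)))).
  apply: eq_avg => // r _.
  transitivity (\sum_(h : cube d K) #|cube d K|%:R^-1 *
      avg (bx n) (fun a => weight n a r * \1_(A n) (a + r *: cube_pt h))).
    rewrite -mulr_sumr -avg_sum -avgZ; apply: eq_avg => // a _.
    by rewrite -mulr_sumr /density; ring.
  apply: eq_bigr => h _; congr (_ * _).
  rewrite !avgE// sum_weight_shift; congr (_ / _).
  by apply: eq_fsbigr => b _; rewrite weight_shift mulrC.
rewrite avg_sum mulr_suml.
apply: eq_bigr => h _; rewrite avgZ mulrC; congr (_ * _).
rewrite -exchange_avg; apply: eq_avg => // b _.
by rewrite !avgZ.
Qed.

(** Cauchy-Schwarz in linear form: [1 - q <= eta + (1 - q)^2 / eta] is an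
    AM-GM inequality, and [eta] is free. *)
Lemma avg_density_ge n (h : cube d K) (eta : R) : 0 < eta ->
  avg (bx n) (fun b => \1_(A n) b * base_weight n b)
    - eta * avg (bx n) (base_weight n) - eta^-1 * weight_variance n h <=
  avg (bx n) (fun b => \1_(A n) b * (base_weight n b * avg_others n h b)).
Proof.
move=> eta0; rewrite -!mulNr -!avgZ -!avgD.
apply: ler_avg => [|b _]; first exact: finite_box.
set q := avg_others n h b; set v := base_weight n b.
have v0 : 0 <= v by exact: base_weight_ge0.
rewrite -subr_ge0.
have -> : \1_(A n) b * (v * q) -
   (\1_(A n) b * v + - eta * v + - eta^-1 * (v * (q - 1) ^+ 2)) =
   v * (eta + eta^-1 * (q - 1) ^+ 2 + \1_(A n) b * (q - 1)) by ring.
apply: mulr_ge0 => //.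
have key : 0 <= eta + eta^-1 * (q - 1) ^+ 2 + (q - 1).
  rewrite -(pmulr_rge0 _ eta0) !mulrDr mulrA divff ?gt_eqF// mul1r.
  rewrite (_ : _ + _ = (eta / 2 + (q - 1)) ^+ 2 + 3 / 4 * eta ^+ 2);
    last by field.
  by rewrite addr_ge0 ?sqr_ge0// mulr_ge0 ?sqr_ge0.
rewrite indicE; case: (_ \in _); rewrite ?mul1r// mul0r addr0.
by rewrite addr_ge0 ?(ltW eta0)// mulr_ge0 ?sqr_ge0// invr_ge0 ltW.
Qed.

Variable delta : R.
Hypothesis A_dens : (delta%:E <= limn_esup (fun n =>
   (avg (bx n) (fun a => \1_(A n) a * \prod_(i < d) nu n i (a ord0 i)))%:E))%E.

(** If every copy of positive weight had density less than [delta - eps], the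
    weighted average of the density would be less than about [delta - eps], as
    the total weight tends to 1. But this average is at least the weighted
    density of [A] itself up to [eta] and the variances, hence the latter would
    have an upper limit less than [delta]. *)
Lemma exists_dense_copy (eps : R) (n0 : nat) : 0 < eps ->
  exists n a r, [/\ (n0 <= n)%N, intvl (M n) r,
    forall h : cube d K, bx n (a + r *: cube_pt h) &
    delta - eps <= density n a r].
Proof.
move=> eps0; apply: contrapT => no; pose c := delta - eps; pose eta := eps / 4.
have eta0 : 0 < eta by rewrite divr_gt0.
have cK : 0 < #|cube d K|%:R :> R.
  by rewrite ltr0n; apply/card_gt0P; exists [ffun=> ord0].
pose u n := avg (bx n) (fun b => \1_(A n) b * base_weight n b).
pose v n := c * avg (J n) (fun r => avg (bx n) (fun a => weight n a r)) +
  (eta * avg (bx n) (base_weight n) +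
   eta^-1 * ((\sum_(h : cube d K) weight_variance n h) / #|cube d K|%:R)).
have uv n : (n0 <= n)%N -> u n <= v n.
  move=> n0n; rewrite /v -lerBlDr.
  apply: (@le_trans _ _ (avg (J n) (fun r => avg (bx n) (fun a =>
      weight n a r * density n a r)))); last first.
    rewrite -avgZ; apply: ler_avg => [|r rJ]; first exact: finite_intvl.
    rewrite -avgZ; apply: ler_avg => [|a _]; first exact: finite_box.
    rewrite mulrC; have [->|w0] := eqVneq (weight n a r) 0.
      by rewrite !mulr0.
    rewrite ler_wpM2r ?weight_ge0// leNgt; apply/negP => /ltW dens.
    apply: no; exists n, a, r; split => // h; exact: (weight_supp h w0).
  rewrite avg_weight_density ler_pdivlMr//.
  apply: (@le_trans _ _ (\sum_(h : cube d K)
      (u n - eta * avg (bx n) (base_weight n) - eta^-1 * weight_variance n h))).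
    rewrite sumrB sumr_const -mulr_sumr -[_ *+ #|_|]mulr_natr le_eqVlt.
    by apply/orP; left; apply/eqP; field; rewrite !gt_eqF.
  by apply: ler_sum => h _; exact: avg_density_ge.
have vc : v n @[n --> \oo] --> c + eta.
  rewrite [X in _ --> X](_ : _ =
    c * 1 + (eta * 1 + eta^-1 * (0 / #|cube d K|%:R))); last first.
    by rewrite mul0r mulr0 addr0 !mulr1.
  apply: cvgD; first by apply: cvgM; [exact: cvg_cst|exact: weight_cvg].
  apply: cvgD; first by apply: cvgM; [exact: cvg_cst|exact: base_weight_cvg].
  apply: cvgM; first exact: cvg_cst.
  apply: cvgM; last exact: cvg_cst.
  rewrite [X in _ --> X](_ : _ = \sum_(h : cube d K) 0); last by rewrite big1.
  by apply: (cvg_big (@add_continuous R)) => h _; exact: weight_variance_cvg.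
have : (limn_esup (fun n => (u n)%:E) <= (c + eta *+ 2)%:E)%E.
  apply: limn_esup_le_near; near=> n; rewrite lee_fin.
  apply: (@le_trans _ _ (v n)); last first.
    by near: n; apply: (cvgr_le _ vc); rewrite mulr2n addrA ltrDl.
  by apply: uv; near: n; exact: nbhs_infty_ge.
have uE : (fun n => (u n)%:E) = (fun n =>
    (avg (bx n) (fun a => \1_(A n) a * \prod_(i < d) nu n i (a ord0 i)))%:E).
  apply/funext => n; congr (_%:E); apply: eq_avg => [|a an].
    exact: finite_box.
  congr (_ * _); apply: eq_bigr => i _; rewrite /w /extend0 ifT//.
  exact/intvlNE.
rewrite uE; apply/negP; rewrite -ltNge; apply: lt_le_trans A_dens.
by rewrite lte_fin /c /eta; lra.
Unshelve. all: by end_near. Qed.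
End patterns.

(** * The multidimensional correspondence for weighted sets *)

Lemma infinite_nat_unbounded (S : set nat) :
  (forall n0, exists2 n, (n0 <= n)%N & S n) -> infinite_set S.
Proof.
move=> unb fS; pose b := \sum_(n <- fset_set S) n.
have [n bn Sn] := unb b.+1.
have : (n <= b)%N.
  rewrite /b (big_fsetD1 n) ?leq_addr//= in_fset_set// inE//.
by rewrite leqNgt bn.
Qed.

Theorem proposition2p5 (R : realType) (d : nat) (d_gt0 : (0 < d)%N)
    (N : nat -> nat) (N_oo : N n @[n --> \oo] --> \oo)
    (M : nat -> R) (M_ge1 : forall n, 1 <= M n)
    (M_oo : M n @[n --> \oo] --> +oo)
    (M_oN : M n / (N n)%:R @[n --> \oo] --> (0 : R))
    (nu : nat -> 'I_d -> int -> R)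
    (nu_ge0 : forall n i (x : int), 1 <= x <= (N n)%:Z -> 0 <= nu n i x)
    (nu_lfc : linear_forms_condition N M nu)
    (A : nat -> set 'rV[int]_d)
    (A_sub : forall n, A n `<=` box (fun _ : 'I_d => (N n)%:R : R))
    (delta : R) (delta_gt0 : 0 < delta)
    (A_dens : (delta%:E <= limn_esup (fun n =>
       (avg (box (fun _ : 'I_d => (N n)%:R : R)) (fun a : 'rV[int]_d =>
          \1_(A n) a * \prod_(i < d) nu n i (a ord0 i)))%:E))%E) :
  exists (disp : measure_display) (X : measurableType disp)
         (mu : probability X R) (T : 'rV[int]_d -> X -> X) (E : set X),
    [/\ is_Zd_system mu T,
        measurable E,
        (delta%:E <= mu E)%E &
        forall (k : nat) (h : 'I_k -> 'rV[int]_d),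
          (0 < mu (\bigcap_(j in [set: 'I_k]) (T (h j) @` E)))%E ->
          infinite_set [set n : nat |
            exists (a : 'rV[int]_d) (r : int),
              [/\ box (fun _ : 'I_d => (N n)%:R : R) a,
                  intvl (M n) r &
                  forall j : 'I_k, A n (a + r *: h j)]]].
Proof.
(* Asking for n >= K in the K-th copy makes the stages unbounded. *)
have copy K : {p : nat * 'rV[int]_d * int |
    [/\ (K <= p.1.1)%N, intvl (M p.1.1) p.2,
      forall h : cube d K,
        box (fun _ : 'I_d => (N p.1.1)%:R : R) (p.1.2 + p.2 *: cube_pt h) &
      delta - K.+1%:R^-1 <= density R K A p.1.1 p.1.2 p.2]}.
  apply: cid; have eps0 : 0 < K.+1%:R^-1 :> R by rewrite invr_gt0.
  have [n [a [r [Kn rM aN dens]]]] :=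
    @exists_dense_copy R d N M nu M_ge1 nu_ge0 nu_lfc K A A_sub delta A_dens
      _ K eps0.
  by exists (n, a, r).
pose n K := (sval (copy K)).1.1; pose a K := (sval (copy K)).1.2.
pose r K := (sval (copy K)).2.
pose x K : config 'rV[int]_d := fun g => `[< A (n K) (a K + r K *: g) >].
have [|disp [X [mu [T [E [sys mE muE pat]]]]]] := @correspondence R d x delta.
  move=> K; have [_ _ _] := svalP (copy K); apply: le_trans.
  by rewrite /density.
exists disp, X, mu, T, E; split => // k h mu_gt0.
apply: infinite_nat_unbounded => n0.
have [K n0K [g gA]] := pat k h mu_gt0 n0.
have [Kn rM aN _] := svalP (copy K).
exists (n K); first exact: leq_trans n0K Kn.
exists (a K + r K *: cube_pt g), (r K); split => // j.
by have /asboolP := gA j; rewrite scalerDr addrA.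
Qed.
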